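(* For real $u$ put $$c(u)=\frac{1-5u^2}{1+5u^2},\qquad s(u)=\frac{2u}{1+5u^2},\qquad F(u)=4c(u)^2+1,$$ and for $u\neq 0$ define $$P(u)=\left(\frac{2(16c^4-12c^2+1)}{F^2},\ \frac{4c(2c^2-1)}{sF^2},\ \frac{c(16c^4-16c^2+3)}{sF^2}\right),$$ where $c,s,F$ are evaluated at $u$. Then the set $$\{P(u):u\in\mathbb{Q}\cap(0,1/6)\}\subset\mathbb{Q}^3$$ is infinite and has rational pairwise Euclidean distances. Moreover, every four distinct points of this set are affinely independent, and no five distinct points of it are cospherical.
   Context: Points are cospherical if they lie on a common sphere in $\mathbb{R}^3$. Distances are standard Euclidean distances. *)

(* Defs.v *)
From mathcomp Require Import all_boot all_order all_algebra.
From mathcomp Require Import mathcomp_extra boolp classical_sets functions.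
From mathcomp Require Import cardinality reals.

Set Implicit Arguments.
Unset Strict Implicit.
Unset Printing Implicit Defensive.

Import Order.TTheory GRing.Theory Num.Theory.

Local Open Scope classical_set_scope.
Local Open Scope ring_scope.

(* The norm that MathComp-Analysis puts on row vectors is the sup norm, so the
   Euclidean distance is defined here. *)
Definition eucl_dist (R : realType) (n : nat) (x y : 'rV[R]_n) : R :=
  Num.sqrt (\sum_(i < n) (x 0 i - y 0 i) ^+ 2).

Definition eucl_sphere (R : realType) (n : nat) (o : 'rV[R]_n) (r : R) :
  set 'rV[R]_n := [set x | eucl_dist o x = r].

Definition cospherical (R : realType) (n k : nat) (p : 'I_k -> 'rV[R]_n) : Prop :=
  exists (o : 'rV[R]_n) (r : R), 0 < r /\ forall i, eucl_sphere o r (p i).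

Definition affinely_independent (R : realType) (n k : nat)
    (p : 'I_k -> 'rV[R]_n) : Prop :=
  forall a : 'I_k -> R,
    \sum_(i < k) a i = 0 -> \sum_(i < k) a i *: p i = 0 -> forall i, a i = 0.

Definition c (R : realType) (u : R) : R := (1 - 5 * u ^+ 2) / (1 + 5 * u ^+ 2).

Definition s (R : realType) (u : R) : R := 2 * u / (1 + 5 * u ^+ 2).

Definition F (R : realType) (u : R) : R := 4 * c u ^+ 2 + 1.

(* Only meaningful for u != 0: s 0 = 0, and division by 0 yields 0. *)
Definition P (R : realType) (u : R) : 'rV[R]_3 :=
  \row_(i < 3)
    [:: 2 * (16 * c u ^+ 4 - 12 * c u ^+ 2 + 1) / F u ^+ 2;
        4 * c u * (2 * c u ^+ 2 - 1) / (s u * F u ^+ 2);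
        c u * (16 * c u ^+ 4 - 16 * c u ^+ 2 + 3) / (s u * F u ^+ 2)]`_i.

Definition Pset (R : realType) : set 'rV[R]_3 :=
  [set P u | u in @rational R `&` [set u : R | 0 < u < 1 / 6]].
Arguments Pset : clear implicits.

(* Main.v *)
Require Import Defs.
From mathcomp Require Import all_boot all_order all_algebra.
From mathcomp Require Import mathcomp_extra boolp classical_sets functions.
From mathcomp Require Import cardinality reals.
From mathcomp Require Import ring lra.

Set Implicit Arguments.
Unset Strict Implicit.
Unset Printing Implicit Defensive.

Import Order.TTheory GRing.Theory Num.Theory.

Local Open Scope classical_set_scope.
Local Open Scope ring_scope.

(** Since [c ^+ 2 + 5 * s ^+ 2 = 1], everything can be made homogeneous in [c]
    and [s]; in particular [F = 5 * (c ^+ 2 + s ^+ 2)].  With the parameter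
    [t = s / c = 2 * u / (1 - 5 * u ^+ 2)], which is injective in [u], rational
    when [u] is, and lies in the interval from 0 to 2/5, the point [P u] becomes
    a point [curve t] of a rational space curve.

    Distances.  The squared distance of two points of this curve is the square
    of a rational function of the two parameters ([eucl_dist_curve]).  As this
    function is nonzero for distinct positive parameters, the points of the
    curve are pairwise distinct, hence the set is infinite.

    Planes and spheres.  Substituting the curve in an equation
    [l * |x|^2 + w . x + w0 = 0] gives, after clearing denominators, a
    polynomial [\sum_k a_k t^k] of degree at most 6 in [t]; its seven
    coefficients depend on five unknowns, and they satisfy the two linear
    relations [25 a1 + 3 a3 + a5 = 0] and [a4 = 375 a0 + 5 a2 - 3 a6].
    Suppose that it has five distinct roots, with elementary symmetric functions
    [e1], ..., [e5].  Dividing by them leaves a factor [a6 * t + b], and the two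
    relations become a homogeneous linear system in [b] and [a6] with
    determinant
      [(1 + 3 e2 + 25 e4) (3 + e2 - 5 e4)
        - (e1 + 3 e3 + 25 e5) (e1 - 5 e3 - 375 e5)].
    For roots between 0 and 2/5 the first product is at least [3 + 9 e2], and
    the second one is at most [e1 ^+ 2 <= 2 * e2 + 4 / 5], so the determinant
    is positive and the polynomial vanishes ([sextic_eq0]).  For a sphere the
    constant coefficient is [l = 1], so that five points are never cospherical
    ([curve_quadric_eq0]).  For a plane, [l = 0] makes [t = 0] an additional
    root, so that four points already are too many ([curve_plane]): a plane is a
    sphere through the point at infinity, which the curve reaches at [t = 0]. *)

(** * Field operations on rational reals *)

Lemma rational_nat (R : realType) n : rational (n%:R : R).
Proof. by exists n%:R => //; rewrite ratr_nat. Qed.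

Lemma rationalD (R : realType) (x y : R) :
  rational x -> rational y -> rational (x + y).
Proof. by move=> [p _ <-] [q _ <-]; exists (p + q); rewrite ?rmorphD. Qed.

Lemma rationalN (R : realType) (x : R) : rational x -> rational (- x).
Proof. by move=> [p _ <-]; exists (- p); rewrite ?rmorphN. Qed.

Lemma rationalM (R : realType) (x y : R) :
  rational x -> rational y -> rational (x * y).
Proof. by move=> [p _ <-] [q _ <-]; exists (p * q); rewrite ?rmorphM. Qed.

Lemma rationalV (R : realType) (x : R) : rational x -> rational x^-1.
Proof. by move=> [p _ <-]; exists p^-1; rewrite ?fmorphV. Qed.

Lemma rationalX (R : realType) (x : R) n : rational x -> rational (x ^+ n).
Proof. by move=> [p _ <-]; exists (p ^+ n); rewrite ?rmorphXn. Qed.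

Lemma rational_norm (R : realType) (x : R) : rational x -> rational `|x|.
Proof. by move=> xQ; case: ger0P => _ //; exact: rationalN. Qed.

Ltac rational_closure :=
  repeat first [assumption | exact: rational_nat | exact: (rational_nat _ 1)
    | apply: rationalX | apply: rationalV | apply: rationalN
    | apply: rationalM | apply: rationalD].

(** * Polynomials of degree six with five given roots *)

(** Here [b] is the constant coefficient of the linear cofactor [a6 * t + b]. *)
Lemma five_roots_of_sextic (K : fieldType) (t1 t2 t3 t4 t5 : K)
    (a0 a1 a2 a3 a4 a5 a6 : K) :
  let e1 := t1 + t2 + t3 + t4 + t5 in
  let e2 := t1 * t2 + t1 * t3 + t1 * t4 + t1 * t5 + t2 * t3 + t2 * t4
            + t2 * t5 + t3 * t4 + t3 * t5 + t4 * t5 in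
  let e3 := t1 * t2 * t3 + t1 * t2 * t4 + t1 * t2 * t5 + t1 * t3 * t4
            + t1 * t3 * t5 + t1 * t4 * t5 + t2 * t3 * t4 + t2 * t3 * t5
            + t2 * t4 * t5 + t3 * t4 * t5 in
  let e4 := t1 * t2 * t3 * t4 + t1 * t2 * t3 * t5 + t1 * t2 * t4 * t5
            + t1 * t3 * t4 * t5 + t2 * t3 * t4 * t5 in
  let e5 := t1 * t2 * t3 * t4 * t5 in
  uniq [:: t1; t2; t3; t4; t5] ->
  {in [:: t1; t2; t3; t4; t5], forall t,
    a0 + a1 * t + a2 * t ^+ 2 + a3 * t ^+ 3 + a4 * t ^+ 4 + a5 * t ^+ 5
    + a6 * t ^+ 6 = 0} ->
  exists b, [/\ a5 = b - a6 * e1, a4 = a6 * e2 - b * e1,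
    a3 = b * e2 - a6 * e3, a2 = a6 * e4 - b * e3 &
    a1 = b * e4 - a6 * e5 /\ a0 = - b * e5].
Proof.
move=> e1 e2 e3 e4 e5 uniq_t root_t; pose b := a5 + a6 * e1.
(* The difference between the sextic and (a6 * t + b) times the product of the
   t - ti has degree at most 4 and five roots. *)
pose D := Poly [:: a0 + b * e5; a1 - (b * e4 - a6 * e5);
  a2 - (a6 * e4 - b * e3); a3 - (b * e2 - a6 * e3); a4 - (a6 * e2 - b * e1)].
have D0 : D = 0.
  apply: (roots_geq_poly_eq0 _ uniq_t); last exact: size_Poly.
  apply/allP => t t_in; rewrite /root horner_Poly /=; apply/eqP.
  have prod0 : (t - t1) * (t - t2) * (t - t3) * (t - t4) * (t - t5) = 0.
    move: t_in; rewrite !inE => /or4P[/eqP->|/eqP->|/eqP->|/orP[]/eqP->];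
    by rewrite subrr !(mulr0, mul0r).
  transitivity (a0 + a1 * t + a2 * t ^+ 2 + a3 * t ^+ 3 + a4 * t ^+ 4
    + a5 * t ^+ 5 + a6 * t ^+ 6 - (a6 * t + b)
      * ((t - t1) * (t - t2) * (t - t3) * (t - t4) * (t - t5))).
    by rewrite /b /e1 /e2 /e3 /e4 /e5; ring.
  by rewrite root_t // prod0 mulr0 subr0.
have coef0 k : [:: a0 + b * e5; a1 - (b * e4 - a6 * e5);
  a2 - (a6 * e4 - b * e3); a3 - (b * e2 - a6 * e3);
  a4 - (a6 * e2 - b * e1)]`_k = 0 by rewrite -coef_Poly -/D D0 coef0.
exists b; split; last split.
- by rewrite /b addrK.
- by apply/eqP; rewrite -subr_eq0; apply/eqP; exact: (coef0 4).
- by apply/eqP; rewrite -subr_eq0; apply/eqP; exact: (coef0 3).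
- by apply/eqP; rewrite -subr_eq0; apply/eqP; exact: (coef0 2).
- by apply/eqP; rewrite -subr_eq0; apply/eqP; exact: (coef0 1).
- by apply/eqP; rewrite mulNr -addr_eq0; apply/eqP; exact: (coef0 0).
Qed.

(** The interval enters only through the positivity of the determinant of the
    system in [b] and [a6]; for the bound 2/5 crude estimates suffice. *)
Lemma sextic_eq0 (K : realFieldType) (ts : seq K) (a0 a1 a2 a3 a4 a5 a6 : K) :
  uniq ts -> size ts = 5 -> {in ts, forall t, 0 <= t <= 2 / 5} ->
  25 * a1 + 3 * a3 + a5 = 0 -> a4 = 375 * a0 + 5 * a2 - 3 * a6 ->
  {in ts, forall t,
    a0 + a1 * t + a2 * t ^+ 2 + a3 * t ^+ 3 + a4 * t ^+ 4 + a5 * t ^+ 5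
    + a6 * t ^+ 6 = 0} ->
  [/\ a0 = 0, a1 = 0, a2 = 0, a3 = 0 & a6 = 0].
Proof.
case: ts => [|t1 [|t2 [|t3 [|t4 [|t5 [|//]]]]]] // uniq_t _ t_bnd.
move=> odd_rel even_rel /(five_roots_of_sextic uniq_t)[b].
set e1 := t1 + _ + _ + _ + _; set e2 := _ + t4 * t5; set e3 := _ + t3 * t4 * t5.
set e4 := _ + t2 * t3 * t4 * t5; set e5 := t1 * t2 * t3 * t4 * t5.
move=> [def5 def4 def3 def2 [def1 def0]].
have [[t1_0 t1_1] [t2_0 t2_1] [t3_0 t3_1] [t4_0 t4_1] [t5_0 t5_1]] :
  [/\ 0 <= t1 /\ t1 <= 2 / 5, 0 <= t2 /\ t2 <= 2 / 5, 0 <= t3 /\ t3 <= 2 / 5,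
      0 <= t4 /\ t4 <= 2 / 5 & 0 <= t5 /\ t5 <= 2 / 5].
  by split; apply/andP/t_bnd; rewrite !inE eqxx ?orbT.
have [e1_0 e2_0 e3_0 e4_0 e5_0] :
  [/\ 0 <= e1, 0 <= e2, 0 <= e3, 0 <= e4 & 0 <= e5].
  by split; rewrite ?addr_ge0 // ?mulr_ge0.
have quad_le (x y z t : K) : 0 <= x -> 0 <= y -> 0 <= z <= 2 / 5 ->
    0 <= t <= 2 / 5 -> 5 * (x * y * z * t) <= x * y.
  move=> x0 y0 z_bnd t_bnd'; have xy0 : 0 <= x * y by rewrite mulr_ge0.
  have zt : z * t <= 4 / 25 by nra.
  rewrite -(mulrA (x * y)); nra.
(* Each of the five products in e4 is at most 4/25 times one of the pairs
   t1 t2, t2 t3, t3 t4, t4 t5, t5 t1, all of which occur in e2. *)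
have e4_le : 5 * e4 <= e2.
  have := quad_le t1 t2 t3 t4; have := quad_le t2 t3 t4 t5.
  have := quad_le t3 t4 t5 t1; have := quad_le t4 t5 t1 t2.
  have := quad_le t5 t1 t2 t3.
  rewrite t1_0 t1_1 t2_0 t2_1 t3_0 t3_1 t4_0 t4_1 t5_0 t5_1.
  do 5! move=> /(_ isT isT isT isT) ?.
  have : [/\ 0 <= t1 * t3, 0 <= t1 * t4, 0 <= t2 * t4, 0 <= t2 * t5
           & 0 <= t3 * t5].
    by split; rewrite mulr_ge0.
  move=> [? ? ? ? ?]; rewrite /e4 /e2; lra.
have e1_sqr : e1 ^+ 2 <= 2 * e2 + 4 / 5.
  have sqr_le (t : K) : 0 <= t -> t <= 2 / 5 -> t ^+ 2 <= 4 / 25 by move=> *; nra.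
  have := sqr_le _ t1_0 t1_1; have := sqr_le _ t2_0 t2_1.
  have := sqr_le _ t3_0 t3_1; have := sqr_le _ t4_0 t4_1.
  have := sqr_le _ t5_0 t5_1; rewrite /e1 /e2; lra.
have odd_eq : b * (1 + 3 * e2 + 25 * e4) = a6 * (e1 + 3 * e3 + 25 * e5).
  by apply/eqP; rewrite -subr_eq0 -odd_rel def1 def3 def5; apply/eqP; ring.
have even_eq : a6 * (3 + e2 - 5 * e4) = b * (e1 - 5 * e3 - 375 * e5).
  by move: even_rel; rewrite def4 def0 def2 => ?; lra.
(* The rest only uses the inequalities between the symmetric functions. *)
move: (e1) (e2) (e3) (e4) (e5) e1_0 e2_0 e3_0 e4_0 e5_0 e4_le e1_sqr
  odd_eq even_eq def5 def4 def3 def2 def1 def0.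
move=> {}e1 {}e2 {}e3 {}e4 {}e5 e1_0 e2_0 e3_0 e4_0 e5_0 e4_le e1_sqr
  odd_eq even_eq def5 def4 def3 def2 def1 def0.
have det_gt0 : 0 < (1 + 3 * e2 + 25 * e4) * (3 + e2 - 5 * e4)
                 - (e1 + 3 * e3 + 25 * e5) * (e1 - 5 * e3 - 375 * e5).
  have lhs : 3 * (1 + 3 * e2) <= (1 + 3 * e2 + 25 * e4) * (3 + e2 - 5 * e4).
    by nra.
  have rhs : (e1 + 3 * e3 + 25 * e5) * (e1 - 5 * e3 - 375 * e5) <= e1 ^+ 2.
    have [p13 p15] : 0 <= e1 * e3 /\ 0 <= e1 * e5 by rewrite !mulr_ge0.
    have [p33 p35 p55] : [/\ 0 <= e3 * e3, 0 <= e3 * e5 & 0 <= e5 * e5].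
      by rewrite !mulr_ge0.
    lra.
  lra.
have a6_0 : a6 = 0.
  (* Cramer's rule: eliminate b between the two equations. *)
  have : a6 * ((1 + 3 * e2 + 25 * e4) * (3 + e2 - 5 * e4)
    - (e1 + 3 * e3 + 25 * e5) * (e1 - 5 * e3 - 375 * e5)) = 0.
    rewrite mulrBr mulrCA even_eq (mulrA a6) -odd_eq; ring.
  by move/eqP; rewrite mulf_eq0 (gt_eqF det_gt0) orbF => /eqP.
have b_0 : b = 0.
  apply/eqP; move/eqP: odd_eq; rewrite a6_0 mul0r mulf_eq0 => /orP[//|].
  by rewrite gt_eqF //; lra.
by rewrite def0 def1 def2 def3 a6_0 b_0; split; ring.
Qed.

(** * The parametrization by the slope *)

(** This is [s u / c u], the value of [t] in [P u = curve t]. *)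
Definition slope (R : realType) (u : R) : R := 2 * u / (1 - 5 * u ^+ 2).

(** The coordinates of [P], made homogeneous by [c ^+ 2 + 5 * s ^+ 2 = 1] and
    then expressed in [t = s / c]. *)
Definition curve (R : realType) (t : R) : 'rV[R]_3 :=
  \row_(i < 3)
    [:: 2 * (1 - 10 * t ^+ 2 + 5 * t ^+ 4) / (5 * (1 + t ^+ 2) ^+ 2);
        4 * (1 - 25 * t ^+ 4) / (25 * t * (1 + t ^+ 2) ^+ 2);
        (3 - 50 * t ^+ 2 + 75 * t ^+ 4) / (25 * t * (1 + t ^+ 2) ^+ 2)]`_i.

Lemma sqrD1_neq0 (R : realType) (t : R) : 1 + t ^+ 2 != 0.
Proof. by rewrite lt0r_neq0// ltr_wpDr ?sqr_ge0. Qed.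

Lemma slope_denom_gt0 (R : realType) (u : R) : 0 < u < 1 / 6 ->
  0 < 1 - 5 * u ^+ 2.
Proof. by move=> u16; nra. Qed.

Lemma slope_bounds (R : realType) (u : R) : 0 < u < 1 / 6 ->
  0 < slope u <= 2 / 5.
Proof.
move=> u16; have d_gt0 := slope_denom_gt0 u16.
rewrite /slope ler_pdivrMr // divr_gt0 //=; nra.
Qed.

Lemma slope_inj (R : realType) (u v : R) : 0 < u < 1 / 6 -> 0 < v < 1 / 6 ->
  slope u = slope v -> u = v.
Proof.
move=> u16 v16 /eqP.
rewrite eqr_div ?(lt0r_neq0 (slope_denom_gt0 _)) // => /eqP uv.
have : (u - v) * (1 + 5 * (u * v)) = 0 by lra.
move/eqP; rewrite mulf_eq0 subr_eq0 => /orP[/eqP//|]; rewrite gt_eqF //; nra.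
Qed.

Lemma P_slope (R : realType) (u : R) : 0 < u < 1 / 6 -> P u = curve (slope u).
Proof.
move=> u16; have d_gt0 := slope_denom_gt0 u16.
have d1 : 1 - 5 * u ^+ 2 != 0 by rewrite gt_eqF.
have d2 : 1 + 5 * u ^+ 2 != 0 by rewrite gt_eqF//; nra.
(* d3 is the numerator of 1 + t ^+ 2, and d4, which is 5 times as large, that
   of F. *)
have d3 : (1 - 5 * u ^+ 2) ^+ 2 + (2 * u) ^+ 2 != 0 by rewrite gt_eqF//; nra.
have d4 : 4 * (1 - 5 * u ^+ 2) ^+ 2 + (1 + 5 * u ^+ 2) ^+ 2 != 0.
  by rewrite gt_eqF//; nra.
have u0 : u != 0 by rewrite gt_eqF//; lra.
apply/rowP => -[[|[|[|//]]] lt_i]; rewrite !mxE /= /F /c /s /slope; field;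
  by rewrite ?u0 ?d1 ?d2 /= d3 d4.
Qed.

(** * Distances on the curve *)

(** The miracle behind the theorem: the squared distance is a perfect square.
    The quadratic factor is symmetric in [t] and [v]; it is [1 + t ^+ 2] for
    [v = 0], where [curve v] has a simple pole, and it grows like
    [(1 + 25 * t ^+ 2) * v ^+ 2] for large [v], where [curve v] tends to
    [(2, 0, 0)].  This determines it up to the coefficient 8 of [t * v]. *)
Lemma eucl_dist_curve (R : realType) (t v : R) : t != 0 -> v != 0 ->
  eucl_dist (curve t) (curve v) =
  `|(t - v) * (1 + t ^+ 2 + v ^+ 2 + 8 * (t * v) + 25 * (t * v) ^+ 2)
    / (5 * t * v * (1 + t ^+ 2) * (1 + v ^+ 2))|.
Proof.
move=> t0 v0; rewrite /eucl_dist -sqrtr_sqr; congr Num.sqrt.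
rewrite !big_ord_recr big_ord0 /= !mxE /=.
by field; rewrite t0 v0 !sqrD1_neq0.
Qed.

(** For positive parameters the distance vanishes only through the factor
    [t - v]. *)
Lemma curve_inj (R : realType) (t v : R) : 0 < t -> 0 < v ->
  curve t = curve v -> t = v.
Proof.
move=> t0 v0 tv; have: eucl_dist (curve t) (curve v) = 0.
  rewrite /eucl_dist tv big1 ?sqrtr0 // => i _.
  by rewrite subrr expr0n.
rewrite eucl_dist_curve ?gt_eqF // => /normr0P.
have tv0 : 0 < t * v by rewrite mulr_gt0.
rewrite !mulf_eq0 invr_eq0 !mulf_eq0 (gt_eqF t0) (gt_eqF v0).
rewrite !(negPf (sqrD1_neq0 _)) subr_eq0.
case/orP => [/orP[/eqP//|]|]; rewrite gt_eqF //; nra.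
Qed.

(** * Planes and spheres meeting the curve *)

(** The degree is only 6, because [\sum_j curve t 0 j ^+ 2] has a denominator
    [25 * t ^+ 2 * (1 + t ^+ 2) ^+ 2] instead of the square of the common
    denominator of the coordinates. *)
Lemma curve_quadric (R : realType) (t l w0 : R) (w : 'rV[R]_3) : t != 0 ->
  l * (\sum_(j < 3) curve t 0 j ^+ 2) + \sum_(j < 3) w 0 j * curve t 0 j + w0 =
  (l + (4 * w 0 1 + 3 * w 0 2) * t + (25 * w0 + 10 * w 0 0 - 10 * l) * t ^+ 2
   + (- 50 * w 0 2) * t ^+ 3 + (25 * l + 50 * w0 - 100 * w 0 0) * t ^+ 4
   + (75 * w 0 2 - 100 * w 0 1) * t ^+ 5
   + (100 * l + 25 * w0 + 50 * w 0 0) * t ^+ 6)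
  / (25 * t ^+ 2 * (1 + t ^+ 2) ^+ 2).
Proof.
move=> t0; rewrite !big_ord_recr !big_ord0 /= !mxE /=.
have -> : widen_ord (leqnSn 2) (widen_ord (leqnSn 1) ord_max) = 0 :> 'I_3.
  exact: val_inj.
have -> : widen_ord (leqnSn 2) ord_max = 1 :> 'I_3 by exact: val_inj.
have -> : ord_max = 2 :> 'I_3 by exact: val_inj.
by field; rewrite t0 sqrD1_neq0.
Qed.

Lemma curve_quadric_root (R : realType) (t l w0 : R) (w : 'rV[R]_3) : t != 0 ->
  l * (\sum_(j < 3) curve t 0 j ^+ 2) + \sum_(j < 3) w 0 j * curve t 0 j + w0
    = 0 ->
  l + (4 * w 0 1 + 3 * w 0 2) * t + (25 * w0 + 10 * w 0 0 - 10 * l) * t ^+ 2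
   + (- 50 * w 0 2) * t ^+ 3 + (25 * l + 50 * w0 - 100 * w 0 0) * t ^+ 4
   + (75 * w 0 2 - 100 * w 0 1) * t ^+ 5
   + (100 * l + 25 * w0 + 50 * w 0 0) * t ^+ 6 = 0.
Proof.
move=> t0; have den0 : 25 * t ^+ 2 * (1 + t ^+ 2) ^+ 2 != 0.
  by rewrite !mulf_neq0 ?expf_neq0 ?sqrD1_neq0 ?pnatr_eq0.
rewrite curve_quadric // => /eqP.
by rewrite mulf_eq0 invr_eq0 (negPf den0) orbF => /eqP.
Qed.

(** This excludes five cospherical points, for which [l] would be 1. *)
Lemma curve_quadric_eq0 (R : realType) (ts : seq R) (l w0 : R) (w : 'rV[R]_3) :
  uniq ts -> size ts = 5 -> {in ts, forall t, 0 < t <= 2 / 5} ->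
  {in ts, forall t, l * (\sum_(j < 3) curve t 0 j ^+ 2)
    + \sum_(j < 3) w 0 j * curve t 0 j + w0 = 0} ->
  l = 0.
Proof.
move=> uniq_ts size_ts ts_bnd on_sphere.
have ts_root t (t_in : t \in ts) := curve_quadric_root
  (lt0r_neq0 (proj1 (andP (ts_bnd t t_in)))) (on_sphere t t_in).
have [] // := sextic_eq0 uniq_ts size_ts _ _ _ ts_root.
- by move=> t /ts_bnd /andP[/ltW-> ->].
- by ring.
- by ring.
Qed.

(** The lacking fifth root is [t = 0]: with [l = 0] the sextic has no constant
    coefficient. *)
Lemma curve_plane (R : realType) (ts : seq R) (w0 : R) (w : 'rV[R]_3) :
  uniq ts -> size ts = 4 -> {in ts, forall t, 0 < t <= 2 / 5} ->
  {in ts, forall t, w0 + \sum_(j < 3) w 0 j * curve t 0 j = 0} ->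
  w0 = 0 /\ w = 0.
Proof.
move=> uniq_ts size_ts ts_bnd on_plane.
have ts0 : 0 \notin ts by apply/negP => /ts_bnd; rewrite ltxx.
have [|||||t|] := @sextic_eq0 _ (0 :: ts) 0 (4 * w 0 1 + 3 * w 0 2)
  (25 * w0 + 10 * w 0 0 - 10 * 0) (- 50 * w 0 2)
  (25 * 0 + 50 * w0 - 100 * w 0 0) (75 * w 0 2 - 100 * w 0 1)
  (100 * 0 + 25 * w0 + 50 * w 0 0).
- by rewrite /= ts0.
- by rewrite /= size_ts.
- by move=> t; rewrite inE => /predU1P[->|/ts_bnd/andP[/ltW-> ->//]]; lra.
- by ring.
- by ring.
- rewrite inE => /predU1P[->|t_in]; first by rewrite !expr0n /=; ring.
  apply: curve_quadric_root; first by have /andP[/gt_eqF->] := ts_bnd t t_in.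
  by rewrite mul0r add0r addrC on_plane.
move=> _ w12 w00 w2 w0'; split; first by lra.
apply/rowP => -[[|[|[|//]]] lt_i]; rewrite mxE.
- have -> : Ordinal lt_i = 0 by exact: val_inj.
  by lra.
- have -> : Ordinal lt_i = 1 by exact: val_inj.
  by lra.
- have -> : Ordinal lt_i = 2 by exact: val_inj.
  by lra.
Qed.

(** Row rank equals column rank: the homogeneous coordinates of the points form
    a square matrix; its left kernel consists of the affine dependencies, and
    its right kernel of the affine functions vanishing at all points. *)
Lemma affinely_independent_no_hyperplane (R : realType) (n : nat)
    (p : 'I_n.+1 -> 'rV[R]_n) :
  (forall (w0 : R) (w : 'rV[R]_n),
    (forall i, w0 + \sum_j w 0 j * p i 0 j = 0) -> w0 = 0 /\ w = 0) ->
  affinely_independent p.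
Proof.
move=> no_plane a sum_a sum_ap.
pose M : 'M[R]_(1 + n) := \matrix_(i < 1 + n) row_mx (1%:M : 'M_1) (p i).
have Ml i (j : 'I_1) : M i (lshift n j) = 1.
  by rewrite mxE row_mxEl mxE !ord1 eqxx.
have Mr i (j : 'I_n) : M i (rshift 1 j) = p i 0 j by rewrite mxE row_mxEr.
have detM : \det M^T != 0.
  apply/det0P => -[w w_neq0 wM]; move/eqP: w_neq0; apply.
  pose wl : 'rV_1 := lsubmx (w : 'rV_(1 + n)).
  pose wr : 'rV_n := rsubmx (w : 'rV_(1 + n)).
  have [|wl0 wr0] := no_plane (wl 0 0) wr.
    move=> i; transitivity ((w *m M^T) 0 i); last by rewrite wM mxE.
    rewrite [RHS]mxE (@big_split_ord _ _ _ 1 n) /= big_ord1; congr (_ + _).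
      by rewrite [M^T _ _]mxE Ml mulr1 mxE.
    by apply: eq_bigr => j _; rewrite [M^T _ _]mxE Mr mxE.
  rewrite -[w](@hsubmxK _ 1 1 n) -/wl -/wr wr0 (_ : wl = 0) ?row_mx0 //.
  by apply/rowP => i; rewrite ord1 wl0 mxE.
have aM : (\row_i a i : 'rV_(1 + n)) *m M = 0.
  apply/rowP => k; rewrite !mxE; case: (@split_ordP 1 n k) => j ->.
    by under eq_bigr do rewrite mxE Ml mulr1.
  under eq_bigr do rewrite mxE Mr.
  transitivity ((\sum_i a i *: p i) 0 j); last by rewrite sum_ap mxE.
  by rewrite summxE; apply: eq_bigr => i _; rewrite mxE.
move=> i; apply/eqP/negPn/negP => ai; move: detM; rewrite det_tr => /det0P.
apply; exists (\row_i a i) => //.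
by apply/eqP => /rowP/(_ i); rewrite !mxE => /eqP; apply/negP.
Qed.

(** * The theorem *)

Lemma Pset_curve (R : realType) (x : 'rV[R]_3) : Pset R x ->
  exists t : R, [/\ rational t, 0 < t <= 2 / 5 & x = curve t].
Proof.
move=> [u [uQ u16] <-]; exists (slope u).
split; [|exact: slope_bounds|exact: P_slope].
by rewrite /slope; rational_closure.
Qed.

Lemma Pset_params (R : realType) (k : nat) (p : 'I_k -> 'rV[R]_3) :
  injective p -> (forall i, Pset R (p i)) ->
  exists ts : seq R, [/\ uniq ts, size ts = k,
    {in ts, forall t, 0 < t <= 2 / 5} &
    {in ts, forall t, exists i, p i = curve t}].
Proof.
move=> p_inj pP; have [t tP] := choice (fun i => Pset_curve (pP i)).
exists [seq t i | i <- enum 'I_k]; split.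
- rewrite map_inj_uniq ?enum_uniq // => i j tij; apply: p_inj.
  by have [[_ _ ->] [_ _ ->]] := (tP i, tP j); rewrite tij.
- by rewrite size_map size_enum_ord.
- by move=> _ /mapP[i _ ->]; have [] := tP i.
- by move=> _ /mapP[i _ ->]; exists i; have [] := tP i.
Qed.

Theorem theorem5p1 (R : realType) :
  [/\ Pset R `<=` [set x : 'rV[R]_3 | forall i : 'I_3, rational (x 0 i)],
      infinite_set (Pset R),
      forall x y : 'rV[R]_3, Pset R x -> Pset R y ->
        rational (eucl_dist x y),
      forall p : 'I_4 -> 'rV[R]_3, injective p -> (forall i, Pset R (p i)) ->
        affinely_independent p
    & forall p : 'I_5 -> 'rV[R]_3, injective p -> (forall i, Pset R (p i)) ->
        ~ cospherical p].
Proof.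
split.
- move=> _ /Pset_curve[t [tQ _ ->]] [[|[|[|//]]] lt_i]; rewrite mxE /=;
  by rational_closure.
- pose u n : R := (n + 7)%:R^-1.
  have u16 n : 0 < u n < 1 / 6.
    rewrite /u invr_gt0 ltr0n addn_gt0 orbT /= mul1r ltf_pV2 ?posrE ?ltr0n //.
      by rewrite ltr_nat ltn_addl.
    by rewrite addn_gt0 orbT.
  have u_inj : injective (fun n => P (u n)).
    move=> m n; rewrite !P_slope // => /curve_inj.
    have /andP[sm _] := slope_bounds (u16 m).
    have /andP[sn _] := slope_bounds (u16 n).
    move=> /(_ sm sn)/(slope_inj (u16 m) (u16 n))/invr_inj/eqP.
    by rewrite eqr_nat eqn_add2r => /eqP.
  move=> finP; apply: infinite_nat.
  rewrite (_ : [set: nat] = (fun n => P (u n)) @^-1` Pset R).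
    by apply: finite_preimage finP => m n _ _ /u_inj.
  apply/seteqP; split => // n _; exists (u n) => //; split => //=.
  by rewrite /u; rational_closure.
- move=> _ _ /Pset_curve[t [tQ /andP[t0 _] ->]]
    /Pset_curve[v [vQ /andP[v0 _] ->]].
  rewrite eucl_dist_curve ?gt_eqF //; apply: rational_norm.
  by rational_closure.
- move=> p p_inj /(Pset_params p_inj)[ts [uniq_ts size_ts ts_bnd ts_p]].
  apply: affinely_independent_no_hyperplane => w0 w on_plane.
  apply: (curve_plane uniq_ts size_ts ts_bnd) => t /ts_p[i <-].
  exact: on_plane.
- move=> p p_inj /(Pset_params p_inj)[ts [uniq_ts size_ts ts_bnd ts_p]].
  move=> [o [r [_ on_sphere]]].
  have on_quadric : {in ts, forall t, 1 * (\sum_(j < 3) curve t 0 j ^+ 2)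
      + \sum_(j < 3) (- 2 *: o) 0 j * curve t 0 j
      + (\sum_(j < 3) o 0 j ^+ 2 - r ^+ 2) = 0}.
    move=> t /ts_p[i <-]; rewrite -(on_sphere i) sqr_sqrtr; last first.
      by apply: sumr_ge0 => j _; exact: sqr_ge0.
    by rewrite !big_ord_recr !big_ord0 /= !mxE; ring.
  have /eqP := curve_quadric_eq0 uniq_ts size_ts ts_bnd on_quadric.
  by rewrite oner_eq0.
Qed.
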